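(* (Correctness of the NI algorithm.) Let $\mathbb{D}=\langle (E_1,t_1),\ldots,(E_n,t_n)\rangle$ be an event sequence with $t_1<\cdots<t_n$ and let $\alpha$ be an $N$-node serial episode. Let $H_{ni}=\{h_1^{ni},\ldots,h_{f'}^{ni}\}$ be the sequence of occurrences of $\alpha$ tracked by the NI algorithm run on $\mathbb{D}$. Then $H_{ni}$ is a maximal non-interleaved sequence of occurrences of $\alpha$ in $\mathbb{D}$: any two of its members are non-interleaved, and its cardinality is at least that of any other set of pairwise non-interleaved occurrences of $\alpha$ in $\mathbb{D}$.
   Context: An event sequence is $\mathbb{D}=\langle (E_1,t_1),\ldots,(E_n,t_n)\rangle$, where each event-type $E_i$ belongs to a finite alphabet and each $t_i$ is a positive integer. An $N$-node serial episode is a sequence of event-types $\alpha=(\alpha[1]\to\cdots\to\alpha[N])$ with nodes $v_1,\ldots,v_N$. An occurrence of $\alpha$ in $\mathbb{D}$ is a map $h:\{v_1,\ldots,v_N\}\to\{1,\ldots,n\}$ with $E_{h(v_i)}=\alpha[i]$ for all $i$ and $t_{h(v_1)}<\cdots<t_{h(v_N)}$. Two occurrences $h_1,h_2$ are non-interleaved if either $t_{h_2(v_j)}\ge t_{h_1(v_{j+1})}$ for all $j=1,\ldots,N-1$, or $t_{h_1(v_j)}\ge t_{h_2(v_{j+1})}$ for all $j=1,\ldots,N-1$. Automata. An automaton for $\alpha$ has states $0,1,\ldots,N$; in state $j<N$ it waits for an event of type $\alpha[j+1]$, and on accepting such an event it moves to state $j+1$. State $0$ is the start state and state $N$ the final state.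 An automaton reaching state $N$ has tracked the occurrence consisting of the $N$ events it accepted; the occurrences tracked by the algorithm are those tracked by automata that reach state $N$. The NI algorithm. Initially there is one automaton, in state $0$. The events are processed in time order. When event $(E_l,t_l)$ is processed, the automata present before this event are considered in order of initialization, oldest first. An automaton in state $j-1$ that is waiting for event-type $E_l$ accepts the event and moves to state $j$ if and only if no earlier-initialized automaton is in state $j$ at that moment (that is, after the older automata have processed the current event); otherwise it stays in state $j-1$. Each automaton makes at most one transition per event. Whenever an automaton leaves state $0$, a new automaton is placed in state $0$ (it does not process the current event). An automaton that reaches state $N$ increments the frequency by $1$ and is immediately removed; no other automata are removed. *)

(* Defs.v *)
From mathcomp Require Import all_boot.

Set Implicit Arguments.
Unset Strict Implicit.
Unset Printing Implicit Defensive.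

Section SerialEpisodes.

Variables (A : finType) (n N : nat).

(* D lists the pairs (event type, time); events and episode nodes are
   numbered from 0. *)
Implicit Types (D : n.-tuple (A * nat)) (alpha : N.-tuple A).
Implicit Types (h : {ffun 'I_N -> 'I_n}) (l : 'I_n).

Definition event_type D l : A := (tnth D l).1.

Definition event_time D l : nat := (tnth D l).2.

Definition is_occurrence D alpha h : Prop :=
  (forall i : 'I_N, event_type D (h i) = tnth alpha i) /\
  (forall i j : 'I_N, i < j -> event_time D (h i) < event_time D (h j)).

Definition follows D h1 h2 : Prop :=
  forall j k : 'I_N, k = j.+1 :> nat -> event_time D (h1 k) <= event_time D (h2 j).

Definition non_interleaved D h1 h2 : Prop := follows D h1 h2 \/ follows D h2 h1.

Definition non_interleaved_set D alpha (S : {set {ffun 'I_N -> 'I_n}}) : Prop :=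
  (forall h, h \in S -> is_occurrence D alpha h) /\
  (forall h1 h2, h1 \in S -> h2 \in S -> h1 != h2 -> non_interleaved D h1 h2).

(* Maximal in cardinality, not merely for inclusion. *)
Definition maximal_non_interleaved D alpha (S : {set {ffun 'I_N -> 'I_n}}) : Prop :=
  non_interleaved_set D alpha S /\
  (forall S' : {set {ffun 'I_N -> 'I_n}},
     non_interleaved_set D alpha S' -> #|S'| <= #|S|).

(* An automaton is the list of the events it has accepted, in order of
   acceptance; its state is the length of that list. *)
Definition automaton : Type := seq 'I_n.

Definition state (a : automaton) : nat := size a.

(* None in the final state N. *)
Definition awaited alpha (a : automaton) : option A := onth alpha (state a).

(* Situation while one event is being processed: [older] are the automata
   already considered for this event and not removed, oldest first; [fresh] are
   the automata initialized during this event, which do not process it;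
   [tracked] are the occurrences tracked so far. *)
Record pass := Pass {
  older : seq automaton;
  fresh : seq automaton;
  tracked : seq {ffun 'I_N -> 'I_n}
}.

Definition accepts D alpha l (p : pass) (a : automaton) : bool :=
  (awaited alpha a == Some (event_type D l)) &&
  ~~ has (fun b => state b == (state a).+1) (older p).

(* [insub] succeeds exactly when the list has length N, that is, when the
   automaton has just reached the final state; it is then removed. *)
Definition consider D alpha l (p : pass) (a : automaton) : pass :=
  if accepts D alpha l p a then
    let a' := rcons a l in
    let fresh' := if state a == 0 then rcons (fresh p) [::] else fresh p in
    match insub a' : option (N.-tuple 'I_n) with
    | Some s => Pass (older p) fresh' (rcons (tracked p) [ffun i => tnth s i])
    | None => Pass (rcons (older p) a') fresh' (tracked p)
    end
  else Pass (rcons (older p) a) (fresh p) (tracked p).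

(* Between events: the automata present, oldest first, and the occurrences
   tracked so far. *)
Definition process_event D alpha
    (c : seq automaton * seq {ffun 'I_N -> 'I_n}) l :
    seq automaton * seq {ffun 'I_N -> 'I_n} :=
  let p := foldl (consider D alpha l) (Pass [::] [::] c.2) c.1 in
  (older p ++ fresh p, tracked p).

(* Events are taken by increasing index, which is time order when the times
   increase along D. *)
Definition ni_occurrences D alpha : seq {ffun 'I_N -> 'I_n} :=
  (foldl (process_event D alpha) ([:: [::]], [::]) (enum 'I_n)).2.

End SerialEpisodes.

(* Main.v *)
(* Keep every automaton ever created, in order of initialization, and let
   e_i(j) be the j-th event accepted by the i-th one.  The acceptance rule gives
   e_i(j+1) <= e_i'(j) for i < i', so the tracked occurrences are pairwise
   non-interleaved.  Conversely, list the members of a competing set by first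
   event as w_0, w_1, and so on; then w_i(j+1) <= w_i'(j) for i < i', and
   induction on events and automata gives e_i(j) <= w_i(j): when w_i(j) arrives,
   the i-th automaton has accepted j events and, since w_i'(j+1) <= w_i(j) for
   i' < i, no older one is still in state j+1 to block it.  Hence every
   competitor is matched by an automaton that finishes. *)
Require Import Defs.
From mathcomp Require Import all_boot.
From mathcomp Require Import zify.

Set Implicit Arguments.
Unset Strict Implicit.
Unset Printing Implicit Defensive.

Section NonInterleaved.

Variables (A : finType) (n N : nat).
Variables (D : n.-tuple (A * nat)) (alpha : N.-tuple A).
Hypothesis N_gt0 : 0 < N.
Hypothesis time_incr :
  forall l m : 'I_n, l < m -> event_time D l < event_time D m.

Implicit Types (a b : seq 'I_n) (o L : seq (seq 'I_n)) (l : 'I_n).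

(** * Indices in place of times, and finished automata as occurrences *)

Lemma event_time_leq l m : (event_time D l <= event_time D m) = (l <= m).
Proof.
case: (ltngtP l m) => [/time_incr/ltnW //|/time_incr|/val_inj->].
- by rewrite ltnNge => /negbTE.
- exact: leqnn.
Qed.

Definition occurrence_of a : option {ffun 'I_N -> 'I_n} :=
  omap (fun s : N.-tuple 'I_n => [ffun i => tnth s i]) (insub a).

Lemma occurrence_ofK : ocancel occurrence_of (fun h => [seq h i | i <- enum 'I_N]).
Proof.
move=> a; rewrite /occurrence_of; case: insubP => //= s _ <-.
rewrite -[RHS]map_tnth_enum.
by apply: eq_map => i; rewrite ffunE.
Qed.

Lemma size_occurrence_of a : occurrence_of a = (size a == N) :> bool.
Proof. by rewrite /occurrence_of; case: insubP => [s -> //|/negbTE ->]. Qed.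

Lemma occurrence_of_None a : size a < N -> occurrence_of a = None.
Proof.
move=> lt_aN; have := size_occurrence_of a; rewrite ltn_eqF //.
by case: occurrence_of.
Qed.

Lemma occurrence_ofP a h : occurrence_of a = Some h ->
  size a = N /\ forall x0 (i : 'I_N), nth x0 a i = h i.
Proof.
move=> ah; split; first by apply/eqP; rewrite -size_occurrence_of ah.
move=> x0 i; have := occurrence_ofK a; rewrite ah /= => <-.
by rewrite (nth_map i) ?size_enum_ord // nth_ord_enum.
Qed.

(** * Simulation of the algorithm without removals *)

(* The list [o] of older automata keeps those in the final state, which the
   algorithm removes and which block nobody. *)
Definition moves l o a : bool :=
  (awaited alpha a == Some (event_type D l)) &&
  ~~ has (fun b => (size b == (size a).+1) && (size b < N)) o.

Definition move l o a := if moves l o a then rcons a l else a.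

Definition move_all l := foldl (fun o a => rcons o (move l o a)).

Definition next L l :=
  let L' := move_all l [::] L in
  if nilp (last [::] L') then L' else rcons L' [::].

Definition history := foldl next [:: [::]].

Definition config L :=
  ([seq a <- L | size a < N], pmap occurrence_of L).

Lemma moves_lt l o a : moves l o a -> size a < N.
Proof.
case/andP=> /eqP aw _; rewrite -(size_tuple alpha) -onthTE.
by rewrite /awaited /state in aw; rewrite aw.
Qed.

(** Dropping final automata from the older list loses no blocker, since [moves] ignores them; an
    automaton that becomes final leaves the first component of [config] and enters the second. *)
Lemma consider_config l o fr a : size a < N ->
  consider D alpha l (Pass (config o).1 fr (config o).2) a =
  let o' := rcons o (move l o a) in
  Pass (config o').1 (if moves l o a && nilp a then rcons fr [::] else fr)
       (config o').2.
Proof.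
move=> lt_aN; rewrite /consider.
have ->: accepts D alpha l (Pass (config o).1 fr (config o).2) a = moves l o a.
  by rewrite /accepts /moves /= !has_count count_filter.
rewrite /move /config /= filter_rcons -!cats1 !pmap_cat /=.
case: ifP => mv /=; last by rewrite lt_aN (occurrence_of_None lt_aN) cats0 !cats1.
rewrite /nilp /state; case: insubP => [s /eqP sN sE|aN].
  by rewrite sN ltnn -sE /occurrence_of valK /= !cats1.
have lt_alN : size (a ++ [:: l]) < N.
  by rewrite ltn_neqAle aN size_cat addn1.
by rewrite lt_alN occurrence_of_None // cats0.
Qed.

Lemma move_all_rcons l o L a :
  move_all l o (rcons L a) = rcons (move_all l o L) (move l (move_all l o L) a).
Proof. exact: foldl_rcons. Qed.

Lemma move_all_cat l o L1 L2 :
  move_all l o (L1 ++ L2) = move_all l (move_all l o L1) L2.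
Proof. exact: foldl_cat. Qed.

Lemma size_move_all l o L : size (move_all l o L) = size o + size L.
Proof.
elim/last_ind: L => [|L a IH]; first by rewrite addn0.
by rewrite move_all_rcons !size_rcons IH addnS.
Qed.

Lemma nth_move_all l L i : i < size L ->
  nth [::] (move_all l [::] L) i =
  move l (take i (move_all l [::] L)) (nth [::] L i).
Proof.
elim/last_ind: L => [//|L a IH]; rewrite size_rcons ltnS => le_iL.
have sz := size_move_all l [::] L.
rewrite move_all_rcons !nth_rcons sz add0n.
case: ltngtP le_iL => // [lt_iL|->] _.
  by rewrite IH // -cats1 takel_cat // sz ltnW.
by rewrite -cats1 take_cat sz add0n ltnn subnn cats0.
Qed.

Lemma move_all_final l L : all (fun a => N <= size a) L -> move_all l [::] L = L.
Proof.
elim/last_ind: L => [//|L a IH]; rewrite all_rcons move_all_rcons.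
case/andP=> aN /IH ->; rewrite /move; case: ifP => // /moves_lt.
by rewrite ltnNge aN.
Qed.

Lemma foldl_consider l o fr L :
  all (fun a => (0 < size a) && (size a < N)) L ->
  foldl (consider D alpha l) (Pass (config o).1 fr (config o).2) L =
  let o' := move_all l o L in Pass (config o').1 fr (config o').2.
Proof.
elim: L o => [//|a L IH] o /= /andP[/andP[a_gt0 lt_aN] LN].
rewrite consider_config //= /nilp eqn0Ngt a_gt0 andbF.
exact: IH.
Qed.

(** * The invariant on automata *)

Definition valid (k : nat) a : Prop :=
  [/\ size a <= N, all (fun x : 'I_n => x < k) a,
      pairwise (fun x y : 'I_n => x < y) a
    & [seq event_type D x | x <- a] = take (size a) alpha].

(** Values in [nat] provide a default even when ['I_n] is empty; for valid automata the size
    condition of [precedes] keeps that default from being read. *)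
Definition pos a j : nat := nth 0 (map val a) j.

Lemma pos_rcons a l j :
  pos (rcons a l) j =
  if j < size a then pos a j else if j == size a then l : nat else 0.
Proof. by rewrite /pos map_rcons nth_rcons size_map. Qed.

(* The size condition says that the state is strictly smaller for the younger
   automaton [b], unless both are final. *)
Definition precedes a b : Prop :=
  minn N (size b).+1 <= size a /\
  forall j, j < size b ->
    pos a j < pos b j /\ (j.+1 < N -> pos a j.+1 <= pos b j).

Definition invariant k L : Prop :=
  [/\ exists L0, L = rcons L0 [::],
      forall a, a \in L -> valid k a
    & forall i j, i < j -> j < size L ->
      precedes (nth [::] L i) (nth [::] L j)].

(** States never increase from older to younger automata, so the final ones form a prefix, and only
    the last automaton is in state 0. *)
Lemma invariant_split k L : invariant k L ->
  exists L1 L2, [/\ L = L1 ++ rcons L2 [::], all (fun a => N <= size a) L1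
    & all (fun a => (0 < size a) && (size a < N)) L2].
Proof.
case=> [[L0 LE] Lv Lp].
have Ldecr: pairwise (fun a b => size b <= size a) L.
  apply/(pairwiseP [::]) => i j _ jL lt_ij; rewrite inE in jL.
  have [szN _ _ _] := Lv _ (mem_nth [::] jL).
  by have [szp _] := Lp _ _ lt_ij jL; move: szp szN => /=; lia.
have Lsplit: L = [seq a <- L | N <= size a] ++ [seq a <- L | size a < N].
  elim: L {LE Lv Lp} Ldecr => //= a L IH /andP[aL /IH {1}->].
  case: (leqP N (size a)) => //= lt_aN.
  have -> : [seq b <- L | N <= size b] = [::].
    apply/eqP; rewrite -(negbK (_ == _)) -has_filter -all_predC.
    apply/allP=> b /(allP aL) /=; lia.
  by [].
rewrite {3}LE filter_rcons N_gt0 in Lsplit.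
exists [seq a <- L | N <= size a], [seq a <- L0 | size a < N]; split=> //.
- by rewrite filter_all.
apply/allP=> a; rewrite mem_filter => /andP[lt_aN aL0]; rewrite lt_aN andbT.
have ia: index a L0 < size L0 by rewrite index_mem.
(* Preceding the empty last automaton forces state at least 1, as [N] is positive. *)
have := Lp _ (size L0) ia; rewrite LE size_rcons => /(_ (ltnSn _)) [].
by rewrite !nth_rcons ia ltnn eqxx nth_index //=; lia.
Qed.

(** Final automata neither move nor block, and those of [L2] create no fresh automaton, so only the
    last one can leave state 0 and cause an empty automaton to be appended. *)
Lemma config_next k L l : invariant k L ->
  config (next L l) = process_event D alpha (config L) l.
Proof.
case/invariant_split=> L1 [L2 [-> L1N L2N]].
have L1E : [seq a <- L1 | size a < N] = [::].
  apply/eqP; rewrite -(negbK (_ == _)) -has_filter -all_predC.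
  by apply: sub_all L1N => a /=; lia.
have L2E : [seq a <- L2 | size a < N] = L2.
  by apply/all_filterP; apply: sub_all L2N => a /andP[].
have L2occ : pmap occurrence_of L2 = [::].
  elim: {L2E} L2 L2N => //= a L2 IH /andP[/andP[_ /occurrence_of_None ->]].
  by move=> /IH.
have nil_occ : occurrence_of [::] = None by rewrite occurrence_of_None.
rewrite /next -rcons_cat move_all_rcons last_rcons.
set o := move_all l [::] _.
rewrite /process_event.
have -> : config (rcons (L1 ++ L2) [::]) = (rcons L2 [::], (config L1).2).
  rewrite /config filter_rcons filter_cat L1E L2E N_gt0.
  rewrite -(cats1 (L1 ++ L2)) !pmap_cat /=.
  by rewrite L2occ nil_occ !cats0.
set p := foldl _ _ _.
have pE : p = Pass (config (rcons o (move l o [::]))).1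
    (if moves l o [::] then [:: [::]] else [::])
    (config (rcons o (move l o [::]))).2.
  have -> : p = foldl (consider D alpha l)
      (Pass (config L1).1 [::] (config L1).2) (rcons L2 [::]).
    by rewrite /p /config L1E.
  rewrite foldl_rcons foldl_consider //.
  have -> : move_all l L1 L2 = o by rewrite /o move_all_cat move_all_final.
  by rewrite /= consider_config //= andbT.
rewrite {}pE /move; case: (moves l o [::]) => /=; last by rewrite cats0.
rewrite /config [in LHS]filter_rcons N_gt0 -(cats1 (rcons _ _)) pmap_cat /=.
by rewrite nil_occ cats0 cats1.
Qed.

(** * Preservation of the invariant *)

Lemma valid_nil k : valid k [::].
Proof. by split; rewrite //= take0. Qed.

Lemma valid_move l o a : valid l a -> valid l.+1 (move l o a).
Proof.
case=> aN a_lt a_incr aE.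
have a_le : all (fun x : 'I_n => x < l.+1) a by apply: sub_all a_lt => x /ltnW.
rewrite /move; case: ifP => [mv|_]; last by split.
have lt_aN := moves_lt mv; have /andP[/eqP aw _] := mv.
split; first by rewrite size_rcons.
- by rewrite all_rcons ltnSn.
- by rewrite pairwise_rcons a_lt.
rewrite map_rcons aE size_rcons (take_nth (event_type D l)) ?size_tuple //.
by rewrite (onth_nth (event_type D l) _ _ _ aw).
Qed.

Lemma size_move_le l o a : size a <= size (move l o a).
Proof. by rewrite /move; case: ifP; rewrite ?size_rcons. Qed.

Lemma pos_move l o a j : j < size a -> pos (move l o a) j = pos a j.
Proof. by rewrite /move; case: ifP => // _ lt_ja; rewrite pos_rcons lt_ja. Qed.

Lemma pos_lt k a j : valid k a -> j < size a -> pos a j < k.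
Proof.
case=> _ /allP a_lt _ _ lt_ja; rewrite /pos; case: a a_lt lt_ja => // x a a_lt lt_ja.
by rewrite (nth_map x) //; apply/a_lt/mem_nth.
Qed.

(** If [b] accepts [l], the updated [a] is not in state [(size b).+1] unless that state is final;
    since it is at least that far, it is then strictly further. This leaves room for the comparisons
    with the new entry of [b]. *)
Lemma precedes_move l o o' a b : valid l a -> valid l b -> precedes a b ->
  move l o a \in o' -> precedes (move l o a) (move l o' b).
Proof.
move=> av bv [szab pab] ao'.
have szaa' := size_move_le l o a.
have posa' := @pos_move l o a; have lta := fun j => @pos_lt _ _ j av.
have lta' := fun j => @pos_lt _ _ j (valid_move o av).
have [aN _ _ _] := valid_move o av; have [bN _ _ _] := bv.
set a' := move l o a in ao' szaa' posa' lta' aN *.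
rewrite {1}/move; case: ifP => [mv|_].
  have lt_bN := moves_lt mv; case/andP: mv => _ /hasPn/(_ _ ao') a'b.
  rewrite /precedes size_rcons; split; first by move: a'b; lia.
  move=> j; rewrite ltnS leq_eqVlt => /orP[/eqP-> | lt_jb].
    rewrite pos_rcons ltnn eqxx posa'; last lia.
    split; first by apply: lta; lia.
    (* [a] may itself accept [l] in this pass, hence only a weak inequality. *)
    by move=> lt_SbN; rewrite -ltnS lta'; lia.
  rewrite pos_rcons lt_jb !posa'; try lia.
  exact: pab.
split; first by lia.
move=> j lt_jb; have [lt_p le_p] := pab _ lt_jb.
by split=> [|jN]; rewrite posa'; [|lia|exact: le_p|lia].
Qed.

(** The appended automaton [[::]] equals the default value, so lookups do not see it. *)
Lemma nth_next L l i : nth [::] (next L l) i = nth [::] (move_all l [::] L) i.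
Proof.
rewrite /next; case: ifP => // _; rewrite nth_rcons.
by case: ltngtP => // [lt_i | ->]; rewrite nth_default // ltnW.
Qed.

Lemma invariant_next L l : invariant l L -> invariant l.+1 (next L l).
Proof.
case=> [[L0 LE] Lv Lp]; set L' := move_all l [::] L.
have sz : size L' = size L := size_move_all l [::] L.
have L'E i : i < size L -> nth [::] L' i = move l (take i L') (nth [::] L i).
  exact: nth_move_all.
have L'v a : a \in L' -> valid l.+1 a.
  case/(nthP [::])=> i; rewrite sz => iL <-; rewrite L'E //.
  exact/valid_move/Lv/mem_nth.
have L'p i j : i < j -> j < size L -> precedes (nth [::] L' i) (nth [::] L' j).
  move=> lt_ij jL; have iL := ltn_trans lt_ij jL.
  rewrite [in nth _ _ j]L'E // [in nth _ _ i]L'E //.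
  apply: precedes_move; first exact/Lv/mem_nth; first exact/Lv/mem_nth.
    exact: Lp.
  rewrite -L'E // -(nth_take _ lt_ij) mem_nth // size_takel //.
  by rewrite sz ltnW.
have [L1 [x L'x]] : exists L1 x, L' = rcons L1 x.
  by rewrite /L' LE move_all_rcons; do 2!eexists.
have szL1 : size L = (size L1).+1 by rewrite -sz L'x size_rcons.
rewrite /invariant /next -/L'; case: ifP => [|x_nil].
  rewrite {1}L'x last_rcons => /nilP x_nil; split=> //.
    by exists L1; rewrite L'x x_nil.
  by move=> i j lt_ij; rewrite sz; apply: L'p.
split; first by exists L'.
  by move=> a; rewrite mem_rcons inE => /predU1P[-> | /L'v //]; apply: valid_nil.
move=> i j lt_ij; rewrite size_rcons ltnS leq_eqVlt sz => /orP[/eqP jE | jL].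
  have -> : nth [::] (rcons L' [::]) j = [::] by rewrite nth_rcons jE sz ltnn eqxx.
  split=> //; rewrite nth_rcons sz -jE lt_ij.
  (* All others must be out of state 0: the youngest old automaton has just left it, and the rest
     precede that one. *)
  rewrite jE szL1 ltnS leq_eqVlt in lt_ij; case/orP: lt_ij => [/eqP-> | lt_i].
    move: x_nil; rewrite L'x last_rcons nth_rcons ltnn eqxx /nilp.
    by rewrite geq_min orbC lt0n => ->.
  have L1L : size L1 < size L by rewrite szL1.
  by have [szi _] := L'p _ _ lt_i L1L; apply: leq_trans szi => /=; lia.
by rewrite !nth_rcons sz jL (ltn_trans lt_ij jL); apply: L'p.
Qed.

Lemma history_rcons es l : history (rcons es l) = next (history es) l.
Proof. exact: foldl_rcons. Qed.

(** The condition on [es] makes it an initial segment of the events in index order; it passes to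
    prefixes. *)
Lemma iota_rcons es l : map val (rcons es l) = iota 0 (size (rcons es l)) ->
  map val es = iota 0 (size es) /\ size es = l.
Proof.
rewrite map_rcons size_rcons -addn1 iotaD cats1 => /rcons_inj[-> ?].
by split.
Qed.

Lemma history_invariant es :
  map val es = iota 0 (size es) -> invariant (size es) (history es).
Proof.
elim/last_ind: es => [_|es l IH].
  split; first by exists [::].
    by move=> a; rewrite inE => /eqP->; apply: valid_nil.
  by move=> i j lt_ij; case: j lt_ij => // j.
case/iota_rcons=> /IH inv lE; rewrite history_rcons size_rcons lE.
by apply: invariant_next; rewrite -lE.
Qed.

Lemma config_history es : map val es = iota 0 (size es) ->
  config (history es) = foldl (process_event D alpha) ([:: [::]], [::]) es.
Proof.
elim/last_ind: es => [_|es l IH].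
  by rewrite /config /= N_gt0 occurrence_of_None.
case/iota_rcons=> esE _; rewrite history_rcons foldl_rcons -IH //.
exact: config_next (history_invariant esE).
Qed.

(** * Comparison with a competing chain *)

(* The competing occurrences, listed in order; the last field compares first
   events, which [follows] does not order when N = 1. *)
Definition occurrence_chain m (w : 'I_m -> {ffun 'I_N -> 'I_n}) : Prop :=
  [/\ forall i, is_occurrence D alpha (w i),
      forall i i' : 'I_m, i < i' -> follows D (w i) (w i')
    & forall (i i' : 'I_m) (j : 'I_N),
      i < i' -> j = 0 :> nat -> w i j < w i' j].

(* The bound e_i(j) <= w_i(j), for the events numbered below [k]. *)
Definition ahead m (w : 'I_m -> {ffun 'I_N -> 'I_n}) k L : Prop :=
  forall (i : 'I_m) (j : 'I_N), w i j < k -> j < size (nth [::] L i).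

Lemma ahead_next m (w : 'I_m -> {ffun 'I_N -> 'I_n}) L l :
  occurrence_chain w -> invariant l L -> ahead w l L -> ahead w l.+1 (next L l).
Proof.
case=> w_occ w_fol w_first [[L0 LE] _ _] Lw i.
have [r] := ubnP (i : nat); elim: r i => // r IH i le_ir j.
rewrite ltnS leq_eqVlt nth_next => /orP[/eqP/val_inj wij|]; last first.
  move=> /Lw lt_j; have iL : i < size L.
    by rewrite ltnNge; apply/negP => iL; rewrite nth_default in lt_j.
  by rewrite nth_move_all //; apply: leq_trans lt_j (size_move_le _ _ _).
have [wE w_incr] := w_occ i.
have le_j : j <= size (nth [::] L i).
  have [-> //|j_gt0] := posnP j.
  have lt_j'N : j.-1 < N by apply: leq_ltn_trans (leq_pred _) _.
  have lt_j' : Ordinal lt_j'N < j by rewrite /= prednK.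
  have := w_incr _ _ lt_j'; rewrite ltnNge event_time_leq -ltnNge wij => /Lw /=.
  by rewrite prednK.
(* Were the [i]-th automaton missing, [j] would be 0; but automaton [i.-1] has left state 0 by
   [ahead], so it cannot be the empty last one or lie beyond it. *)
have iL : i < size L.
  rewrite LE size_rcons ltnS leqNgt; apply/negP => iL0.
  have j0 : j = 0 :> nat.
    by move: le_j; rewrite nth_default ?leqn0 ?LE ?size_rcons // => /eqP.
  have lt_i'm : i.-1 < m by apply: leq_ltn_trans (leq_pred _) _.
  have lt_i' : Ordinal lt_i'm < i by rewrite /= prednK //; apply: leq_ltn_trans iL0.
  have := w_first _ _ _ lt_i' j0; rewrite wij => /Lw; rewrite j0 /= LE nth_rcons.
  case: (ltngtP i.-1 (size L0)) => // lt_i1.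
  by move: lt_i' iL0 lt_i1 => /=; lia.
rewrite nth_move_all //.
have [lt_j|ge_j] := ltnP j (size (nth [::] L i)).
  exact: leq_trans lt_j (size_move_le _ _ _).
have jE : size (nth [::] L i) = j by apply/eqP; rewrite eqn_leq ge_j.
rewrite /move; suff -> : moves l (take i (move_all l [::] L)) (nth [::] L i).
  by rewrite size_rcons jE.
apply/andP; split.
  by apply/eqP; rewrite /awaited /state jE; apply/tnth_onth; rewrite -wE wij.
(* A blocker has already processed [l], so the inner induction over older automata is what excludes
   it, rather than the hypothesis on [L]. *)
apply/hasPn => b /(nthP [::])[i' ]; rewrite size_take size_move_all add0n iL.
move=> lt_i' <-; rewrite nth_take // jE; apply/negP => /andP[/eqP bE].
rewrite bE => lt_SjN.
have lt_i'm : i' < m := ltn_trans lt_i' (ltn_ord i).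
have := w_fol (Ordinal lt_i'm) i lt_i' j (Ordinal lt_SjN) erefl.
rewrite event_time_leq wij -ltnS => /IH.
by rewrite nth_next bE ltnn => /(_ (leq_trans lt_i' le_ir)).
Qed.

Lemma ahead_history m (w : 'I_m -> {ffun 'I_N -> 'I_n}) es :
  occurrence_chain w -> map val es = iota 0 (size es) ->
  ahead w (size es) (history es).
Proof.
move=> w_chain; elim/last_ind: es => [_ i j //|es l IH].
case/iota_rcons=> esE lE; rewrite history_rcons size_rcons lE.
by apply: ahead_next => //; rewrite -lE; [apply: history_invariant|apply: IH].
Qed.

(** * Consequences for the tracked occurrences *)

Lemma enum_ord_iota : map val (enum 'I_n) = iota 0 (size (enum 'I_n)).
Proof. by rewrite size_enum_ord; exact: val_enum_ord. Qed.

(** [ahead] at the last node shows that each of the first [m] automata has accepted [N] events. *)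
Lemma occurrence_chain_size m (w : 'I_m -> {ffun 'I_N -> 'I_n}) :
  occurrence_chain w -> m <= size (ni_occurrences D alpha).
Proof.
move=> w_chain; have esE := enum_ord_iota.
rewrite /ni_occurrences -config_history //; set L := history _.
have [_ Lv _] := history_invariant esE; rewrite -/L in Lv.
have LN i : i < m -> i < size L /\ size (nth [::] L i) = N.
  move=> im; have lt_N1N : N.-1 < N by rewrite prednK.
  have lt_w : w (Ordinal im) (Ordinal lt_N1N) < size (enum 'I_n).
    by rewrite size_enum_ord.
  have := ahead_history w_chain esE lt_w; rewrite -/L /= prednK // => szN.
  have iL : i < size L.
    rewrite ltnNge; apply/negP => iL.
    by move: szN; rewrite nth_default //=; lia.
  have [leN _ _ _] := Lv _ (mem_nth [::] iL); split=> //.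
  by apply/eqP; rewrite eqn_leq leN.
have le_mL : m <= size L.
  by case: m LN {w w_chain} => // m LN; case: (LN m).
rewrite /= size_pmap -(cat_take_drop m L) count_cat.
apply: leq_trans (leq_addr _ _).
suff : all occurrence_of (take m L).
  by rewrite all_count size_takel // => /eqP ->.
apply/(all_nthP [::]) => i; rewrite size_takel // => im.
by rewrite size_occurrence_of nth_take //; have [_ ->] := LN _ im.
Qed.

(** For two finished automata the weak inequality in [precedes] is [follows], the older one first;
    event types and order come from [valid]. *)
Lemma ni_occurrencesP h1 h2 :
  h1 \in ni_occurrences D alpha -> h2 \in ni_occurrences D alpha ->
  is_occurrence D alpha h1 /\ (h1 != h2 -> non_interleaved D h1 h2).
Proof.
have esE := enum_ord_iota.
rewrite /ni_occurrences -config_history //; set L := history _.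
have [_ Lv Lp] := history_invariant esE; rewrite -/L in Lv Lp.
have Lh h : h \in pmap occurrence_of L ->
    exists2 i, i < size L & occurrence_of (nth [::] L i) = Some h.
  by rewrite mem_pmap => /mapP[a /(nthP [::])[i iL <-] ->]; exists i.
have Lfol i i' h h' : i < i' -> i' < size L ->
    occurrence_of (nth [::] L i) = Some h ->
    occurrence_of (nth [::] L i') = Some h' -> follows D h h'.
  move=> lt_ii' i'L /occurrence_ofP[aN ah] /occurrence_ofP[a'N a'h] j k kE.
  have [_ /(_ j)] := Lp _ _ lt_ii' i'L; rewrite a'N ltn_ord => /(_ isT)[_].
  rewrite -kE ltn_ord event_time_leq /pos => /(_ isT).
  by rewrite !(nth_map (h j)) ?aN ?a'N // ah a'h.
move=> /Lh[i1 i1L h1E] /Lh[i2 i2L h2E]; split.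
  have [_ _ a_incr aE] := Lv _ (mem_nth [::] i1L).
  have [aN ah] := occurrence_ofP h1E; split=> [i|i j lt_ij].
    have := congr1 (nth (event_type D (h1 i)) ^~ i) aE.
    rewrite (nth_map (h1 i)) ?aN // ah nth_take // => ->.
    by rewrite -tnth_nth.
  have := pairwiseP (h1 i) a_incr i j; rewrite !inE aN !ltn_ord !ah.
  by move/(_ isT isT lt_ij)/time_incr.
case: (ltngtP i1 i2) => [lt_i|lt_i|iE].
- by left; apply: Lfol lt_i i2L h1E h2E.
- by right; apply: Lfol lt_i i1L h2E h1E.
- by move: h2E; rewrite -iE h1E => -[->]; rewrite eqxx.
Qed.

(** Two equal automata would be nonempty by the size condition of [precedes], and their first event
    would be strictly before itself. *)
Lemma ni_occurrences_uniq : uniq (ni_occurrences D alpha).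
Proof.
have esE := enum_ord_iota.
rewrite /ni_occurrences -config_history //; set L := history _.
have [_ _ Lp] := history_invariant esE; rewrite -/L in Lp.
have Lneq i j : i < j -> j < size L -> nth [::] L i <> nth [::] L j.
  move=> lt_ij jL E; have [szE] := Lp _ _ lt_ij jL; rewrite E in szE *.
  by case/(_ 0); [lia | rewrite ltnn].
apply: pmap_uniq occurrence_ofK _ _; apply/(uniqP [::]) => i j iL jL E.
by case: (ltngtP i j) => // lt_ij; have := Lneq _ _ lt_ij; case; rewrite // E.
Qed.

(** Sorting by first event decides which direction of non-interleaving holds. *)
Lemma non_interleaved_set_chain (S : {set {ffun 'I_N -> 'I_n}}) :
  non_interleaved_set D alpha S ->
  exists w : 'I_#|S| -> {ffun 'I_N -> 'I_n}, occurrence_chain w.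
Proof.
case=> S_occ S_ni; pose j0 := Ordinal N_gt0.
pose hle (h h' : {ffun 'I_N -> 'I_n}) := h j0 <= h' j0.
have hle_total : total hle by move=> h h'; apply: leq_total.
have hle_trans : transitive hle by move=> h h' h''; apply: leq_trans.
pose s := sort hle (enum S).
have sS : size s == #|S| by rewrite size_sort cardE.
pose t : #|S|.-tuple _ := Tuple sS; exists (tnth t).
have tS i : tnth t i \in S by rewrite -mem_enum -(mem_sort hle) mem_tnth.
have t_neq (i i' : 'I_#|S|) : i < i' -> tnth t i != tnth t i'.
  have /tuple_uniqP t_inj : uniq t by rewrite /= sort_uniq enum_uniq.
  by move=> lt_i; apply/eqP => /t_inj E; rewrite E ltnn in lt_i.
have t_le (i i' : 'I_#|S|) : i < i' -> tnth t i j0 <= tnth t i' j0.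
  move=> lt_i; set x0 := tnth t i; rewrite {1}/x0 !(tnth_nth x0).
  have := sorted_ltn_nth hle_trans x0 (sort_sorted hle_total (enum S)).
  by move/(_ i i'); apply; rewrite // inE (eqP sS).
have t_both (i i' : 'I_#|S|) : i < i' ->
    follows D (tnth t i) (tnth t i') /\ tnth t i j0 < tnth t i' j0.
  move=> lt_i; have [_ incr] := S_occ _ (tS i); have [_ incr'] := S_occ _ (tS i').
  have ni := S_ni _ _ (tS i) (tS i') (t_neq _ _ lt_i).
  have [lt_1N|le_N1] := ltnP 1 N.
    pose j1 : 'I_N := Ordinal lt_1N.
    have lt_j := incr j0 j1 isT; have lt_j' := incr' j0 j1 isT.
    have lt_t : follows D (tnth t i) (tnth t i') -> tnth t i j0 < tnth t i' j0.
      move/(_ j0 j1 erefl) => /(leq_trans lt_j).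
      by rewrite !ltnNge !event_time_leq.
    case: ni => fol; first by split=> //; apply: lt_t.
    (* The opposite direction would make [tnth t i'] start first, against the sorting. *)
    have := leq_trans lt_j' (fol j0 j1 erefl).
    by rewrite ltnNge event_time_leq t_le.
  (* For [N = 1], [follows] is vacuous, and strictness holds because an occurrence is determined by
     its only event. *)
  have N1 : forall j : 'I_N, j = j0 by move=> j; apply/val_inj; have := ltn_ord j => /=; lia.
  split; first by move=> j k; rewrite (N1 k) (N1 j).
  rewrite ltn_neqAle t_le // andbT; apply: contraNneq (t_neq _ _ lt_i).
  by move/val_inj => E; apply/eqP/ffunP => j; rewrite (N1 j).
split=> [i|i i' /t_both[]//|i i' j /t_both[_ lt_t] jE]; first exact: S_occ.
by have -> : j = j0 by apply/val_inj.
Qed.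

End NonInterleaved.

Theorem mainTheorem6 (A : finType) (n N : nat)
    (D : n.-tuple (A * nat)) (alpha : N.-tuple A)
    (N_gt0 : 0 < N)
    (time_gt0 : forall l : 'I_n, 0 < event_time D l)
    (time_incr : forall l m : 'I_n, l < m -> event_time D l < event_time D m) :
  uniq (ni_occurrences D alpha) /\
  maximal_non_interleaved D alpha [set h in ni_occurrences D alpha].
Proof.
have ni_uniq : uniq (ni_occurrences D alpha) by apply: ni_occurrences_uniq.
split=> //; split; first split=> [h|h1 h2].
- by rewrite inE => hL; have [] := ni_occurrencesP N_gt0 time_incr hL hL.
- rewrite !inE => h1L h2L.
  by have [] := ni_occurrencesP N_gt0 time_incr h1L h2L.
move=> S /(non_interleaved_set_chain N_gt0 time_incr)[w w_chain].
rewrite cardsE (card_uniqP ni_uniq).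
exact: (occurrence_chain_size N_gt0 time_incr w_chain).
Qed.
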